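(* Fix an algorithm that assigns to each consistent recursively enumerable theory $T\supseteq\mathsf{Q}$ a Chaitin constant $c_T$. That is, $c_T$ is computed from a description of $T$, and for every $e\geqslant c_T$ and every $w$ we have $T\nvdash\text{``}\mathscr{K}(w)>e\text{''}$. Then there is no algorithm which, given a consistent recursively enumerable theory $T\supseteq\mathsf{Q}$, computes a number $w_T$ such that both $T\nvdash\text{``}\mathscr{K}(w_T)>c_T\text{''}$ and $\mathscr{K}(w_T)>c_T$ hold.
   Context: $\varphi_0,\varphi_1,\dots$ is a standard acceptable enumeration of the unary partial recursive functions. $\mathscr{K}(m)=\min\{i\in\mathbb{N}\mid\varphi_i(0)\!\downarrow=m\}$ is the Kolmogorov–Chaitin complexity. $\text{``}\mathscr{K}(w)>e\text{''}$ is the natural arithmetical formalization, namely the negation of the $\Sigma_1$-sentence saying some $i\leqslant e$ has $\varphi_i(0)\!\downarrow=w$. Theories are given by descriptions such as indices of enumerations of their axioms. $\mathsf{Q}$ is Robinson's arithmetic. *)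

(* Defs.v *)
From mathcomp Require Import all_boot.
Set Implicit Arguments.
Unset Strict Implicit.
Unset Printing Implicit Defensive.

(** * Partial recursive functions *)

Inductive prf : nat -> Type :=
| Zero n : prf n
| Succ : prf 1
| Proj n (i : 'I_n) : prf n
| Comp m n (f : prf m) (g : 'I_m -> prf n) : prf n
| Prec n (base : prf n) (step : prf n.+2) : prf n.+1
| Mu n (f : prf n.+1) : prf n.

(** [eval f v y] means that f(v) converges with value y.  Recursion is on the
    first argument: f(0, v) = base(v) and f(k+1, v) = step(k, f(k, v), v).
    [Mu f] maps v to the least y with f(y, v) = 0, all the values f(z, v) with
    z < y being required to converge. *)
Fixpoint eval n (f : prf n) : n.-tuple nat -> nat -> Prop :=
  match f in prf n return n.-tuple nat -> nat -> Prop with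
  | Zero _ => fun _ y => y = 0
  | Succ => fun v y => y = (thead v).+1
  | Proj _ i => fun v y => y = tnth v i
  | Comp m _ f g => fun v y =>
      exists u : m.-tuple nat,
        (forall i, eval (g i) v (tnth u i)) /\ eval f u y
  | Prec _ base step => fun v y =>
      (fix iterate (k y : nat) : Prop :=
         match k with
         | 0 => eval base (behead_tuple v) y
         | k'.+1 => exists2 z, iterate k' z &
             eval step [tuple of k' :: z :: behead_tuple v] y
         end) (thead v) y
  | Mu _ f => fun v y =>
      eval f [tuple of y :: v] 0 /\
      forall z, z < y -> exists u, eval f [tuple of z :: v] u.+1
  end.

(** For [phi : numbering], [phi i x y] means that phi_i(x) converges with
    value y. *)
Definition numbering := nat -> nat -> nat -> Prop.

Definition recursive (s : nat -> nat) : Prop :=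
  exists g : prf 1, forall x y, eval g [tuple x] y <-> y = s x.

(** Acceptability in the sense of Rogers: the numbering enumerates exactly the
    unary partial recursive functions, has a partial recursive universal
    function, and satisfies the s-m-n property. *)
Record acceptable (phi : numbering) : Prop := Acceptable {
  acceptable_universal :
    exists u : prf 2, forall i x y, eval u [tuple i; x] y <-> phi i x y;
  acceptable_onto :
    forall f : prf 1, exists i, forall x y, phi i x y <-> eval f [tuple x] y;
  acceptable_smn :
    forall f : prf 2, exists2 s : nat -> nat, recursive s &
      forall x y z, phi (s x) y z <-> eval f [tuple x; y] z
}.

Definition kolmogorov (phi : numbering) (m k : nat) : Prop :=
  phi k 0 m /\ forall i, phi i 0 m -> k <= i.

(** * First-order arithmetic, with de Bruijn indices *)

Inductive term : Type :=
| TVar (x : nat)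
| TZero
| TSucc (t : term)
| TAdd (s t : term)
| TMul (s t : term).

Inductive form : Type :=
| Eq (s t : term)
| Bot
| Imp (A B : form)
| All (A : form).

Definition Neg A := Imp A Bot.
Definition And A B := Neg (Imp A (Neg B)).
Definition Ex A := Neg (All (Neg A)).

Fixpoint subst_term (sigma : nat -> term) (t : term) : term :=
  match t with
  | TVar x => sigma x
  | TZero => TZero
  | TSucc t => TSucc (subst_term sigma t)
  | TAdd s t => TAdd (subst_term sigma s) (subst_term sigma t)
  | TMul s t => TMul (subst_term sigma s) (subst_term sigma t)
  end.

Definition shift (x : nat) : term := TVar x.+1.

Definition scons (t : term) (sigma : nat -> term) (x : nat) : term :=
  if x is y.+1 then sigma y else t.

Definition up (sigma : nat -> term) : nat -> term :=
  scons (TVar 0) (fun x => subst_term shift (sigma x)).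

Fixpoint subst (sigma : nat -> term) (A : form) : form :=
  match A with
  | Eq s t => Eq (subst_term sigma s) (subst_term sigma t)
  | Bot => Bot
  | Imp A B => Imp (subst sigma A) (subst sigma B)
  | All A => All (subst (up sigma) A)
  end.

Definition inst (t : term) (A : form) : form := subst (scons t TVar) A.

Fixpoint numeral (n : nat) : term :=
  if n is m.+1 then TSucc (numeral m) else TZero.

Definition Le (s t : term) : form :=
  Ex (Eq (TAdd (TVar 0) (subst_term shift s)) (subst_term shift t)).

(** All free variables are below [n]. *)
Fixpoint term_below (n : nat) (t : term) : bool :=
  match t with
  | TVar x => x < n
  | TZero => true
  | TSucc t => term_below n t
  | TAdd s t | TMul s t => term_below n s && term_below n t
  end.

Fixpoint form_below (n : nat) (A : form) : bool :=
  match A with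
  | Eq s t => term_below n s && term_below n t
  | Bot => true
  | Imp A B => form_below n A && form_below n B
  | All A => form_below n.+1 A
  end.

Definition sentence (A : form) : bool := form_below 0 A.

(** [Le] abbreviates an existential formula but is treated here as an atom, as in
    the usual definition of bounded formulas. *)
Inductive Delta0 : form -> Prop :=
| Delta0_Eq s t : Delta0 (Eq s t)
| Delta0_Le s t : Delta0 (Le s t)
| Delta0_Bot : Delta0 Bot
| Delta0_Imp A B : Delta0 A -> Delta0 B -> Delta0 (Imp A B)
| Delta0_All t A : Delta0 A ->
    Delta0 (All (Imp (Le (TVar 0) (subst_term shift t)) A)).

Inductive Sigma1 : form -> Prop :=
| Sigma1_Delta0 A : Delta0 A -> Sigma1 A
| Sigma1_Ex A : Sigma1 A -> Sigma1 (Ex A).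

(** Natural deduction for classical first-order logic with equality, from a
    possibly infinite set of assumptions. *)
Inductive provable : (form -> Prop) -> form -> Prop :=
| P_Hyp (G : form -> Prop) A : G A -> provable G A
| P_ImpI (G : form -> Prop) A B :
    provable (fun C => C = A \/ G C) B -> provable G (Imp A B)
| P_ImpE (G : form -> Prop) A B :
    provable G (Imp A B) -> provable G A -> provable G B
| P_Contra (G : form -> Prop) A :
    provable (fun C => C = Neg A \/ G C) Bot -> provable G A
| P_AllI (G : form -> Prop) A :
    provable (fun C => exists2 B, G B & C = subst shift B) A ->
    provable G (All A)
| P_AllE (G : form -> Prop) A t : provable G (All A) -> provable G (inst t A)
| P_EqRefl (G : form -> Prop) t : provable G (Eq t t)
| P_EqSubst (G : form -> Prop) A s t :
    provable G (Eq s t) -> provable G (inst s A) -> provable G (inst t A).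

Definition consistent (T : form -> Prop) : Prop := ~ provable T Bot.

Inductive robinson : form -> Prop :=
| Q_succ_neq0 : robinson (All (Neg (Eq (TSucc (TVar 0)) TZero)))
| Q_succ_inj : robinson (All (All
    (Imp (Eq (TSucc (TVar 1)) (TSucc (TVar 0))) (Eq (TVar 1) (TVar 0)))))
| Q_pred : robinson (All
    (Imp (Neg (Eq (TVar 0) TZero)) (Ex (Eq (TVar 1) (TSucc (TVar 0))))))
| Q_add0 : robinson (All (Eq (TAdd (TVar 0) TZero) (TVar 0)))
| Q_addS : robinson (All (All
    (Eq (TAdd (TVar 1) (TSucc (TVar 0))) (TSucc (TAdd (TVar 1) (TVar 0))))))
| Q_mul0 : robinson (All (Eq (TMul (TVar 0) TZero) TZero))
| Q_mulS : robinson (All (All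
    (Eq (TMul (TVar 1) (TSucc (TVar 0)))
        (TAdd (TMul (TVar 1) (TVar 0)) (TVar 1))))).

Fixpoint value (rho : nat -> nat) (t : term) : nat :=
  match t with
  | TVar x => rho x
  | TZero => 0
  | TSucc t => (value rho t).+1
  | TAdd s t => value rho s + value rho t
  | TMul s t => value rho s * value rho t
  end.

(** Truth in the standard model. *)
Fixpoint sat (rho : nat -> nat) (A : form) : Prop :=
  match A with
  | Eq s t => value rho s = value rho t
  | Bot => False
  | Imp A B => sat rho A -> sat rho B
  | All A => forall a, sat (fun x => if x is y.+1 then rho y else a) A
  end.

(** * Theories given by indices *)

(** An injective pairing function; surjectivity is not needed for Goedel
    numbering. *)
Definition pair_code (x y : nat) : nat := (x + y) ^ 2 + y.

Fixpoint code_term (t : term) : nat :=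
  match t with
  | TVar x => pair_code 0 x
  | TZero => pair_code 1 0
  | TSucc t => pair_code 2 (code_term t)
  | TAdd s t => pair_code 3 (pair_code (code_term s) (code_term t))
  | TMul s t => pair_code 4 (pair_code (code_term s) (code_term t))
  end.

Fixpoint code (A : form) : nat :=
  match A with
  | Eq s t => pair_code 0 (pair_code (code_term s) (code_term t))
  | Bot => pair_code 1 0
  | Imp A B => pair_code 2 (pair_code (code A) (code B))
  | All A => pair_code 3 (code A)
  end.

(** The axioms enumerated by phi_d: the sentences whose Goedel number is in the
    range of phi_d.  Every r.e. set of sentences is of this form. *)
Definition axioms (phi : numbering) (d : nat) (A : form) : Prop :=
  sentence A /\ exists n, phi d n (code A).

(** The theory with index d is consistent and contains Robinson's arithmetic;
    containment is between deductive closures. *)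
Definition admissible (phi : numbering) (d : nat) : Prop :=
  consistent (axioms phi d) /\
  forall A, robinson A -> provable (axioms phi d) A.

(** [theta] is a Sigma_1 formula expressing "phi_i(0) converges to w", where
    i is variable 0 and w is variable 1. *)
Definition arithmetizes (phi : numbering) (theta : form) : Prop :=
  [/\ Sigma1 theta, form_below 2 theta &
      forall i w, sat (nth 0 [:: i; w]) theta <-> phi i 0 w].

(** The sentence "K(w) > e": no i <= e satisfies [theta] with w.  Under the
    quantifier, variable 0 is i. *)
Definition K_gt (theta : form) (w e : nat) : form :=
  Neg (Ex (And (Le (TVar 0) (numeral e))
               (subst (nth TZero [:: TVar 0; numeral w]) theta))).

(* Main.v *)
Require Import Defs.
From mathcomp Require Import all_boot.

(** Suppose that [w] is such an algorithm.  For admissible [d] the sentence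
    "K(w(d)) > c(d)" is true, so [Q] together with it is a true, hence consistent,
    theory; its index [s d] is computable from [d], and [c (s d)] must exceed [c d].
    Iterating [s] from an index of [Q] yields a computable sequence [D n] with
    [n <= c (D n) < K (w (D n))].  This is Berry's paradox: by Kleene's recursion
    theorem some [p] satisfies phi_p(0) = w(D p), whence K(w(D p)) <= p. *)

Set Implicit Arguments.
Unset Strict Implicit.
Unset Printing Implicit Defensive.

(** * Recursive functions *)

Lemma eval_functional n (f : prf n) v y z : eval f v y -> eval f v z -> y = z.
Proof.
elim: n / f v y z => [n|| n i | m n f IHf g IHg | n b IHb s IHs | n f IHf] v y z /=.
- by move=> -> ->.
- by move=> -> ->.
- by move=> -> ->.
- move=> [u [Hu Hy]] [u' [Hu' Hz]].
  have E : u = u' by apply: eq_from_tnth => i; apply: IHg (Hu i) (Hu' i).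
  by rewrite -E in Hz; apply: IHf Hy Hz.
- elim: (thead v) y z => [|k IHk] y z; first exact: IHb.
  by move=> [a Ha Hy] [a' /(IHk _ _ Ha) <-]; apply: IHs.
- move=> [Hy Ly] [Hz Lz]; case: (ltngtP y z) => // [/Lz|/Ly] [u Hu].
  + by have := IHf _ _ _ Hy Hu.
  + by have := IHf _ _ _ Hz Hu.
Qed.

(** By functionality the intermediate tuple can only be [u], so the existential in [eval]
    disappears. *)
Lemma eval_comp m n (f : prf m) (g : 'I_m -> prf n) v u y :
  (forall i, eval (g i) v (tnth u i)) -> eval (Comp f g) v y <-> eval f u y.
Proof.
move=> Hu; split=> [[u' [Hu' Hy]]|Hy]; last by exists u.
suff -> : u = u' by [].
by apply: eq_from_tnth => i; apply: eval_functional (Hu i) (Hu' i).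
Qed.

Definition computable n (F : n.-tuple nat -> nat) : Prop :=
  exists f : prf n, forall v y, eval f v y <-> y = F v.

Definition computable_tuple n m (G : n.-tuple nat -> m.-tuple nat) : Prop :=
  forall i, computable (fun v => tnth (G v) i).

Lemma eq_computable n (F F' : n.-tuple nat -> nat) :
  F =1 F' -> computable F -> computable F'.
Proof. by move=> E [f Hf]; exists f => v y; rewrite -E. Qed.

Lemma computable_comp m n (F : m.-tuple nat -> nat) (G : n.-tuple nat -> m.-tuple nat) :
  computable F -> computable_tuple G -> computable (fun v => F (G v)).
Proof.
move=> [f Hf] /fin_all_exists [g Hg]; exists (Comp f g) => v y.
apply: iff_trans (Hf _ _); apply: eval_comp => i; exact/Hg.
Qed.

Lemma computable_tnth n (i : 'I_n) : computable (fun v => tnth v i).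
Proof. by exists (Proj i). Qed.

Lemma computable_tuple_id n : computable_tuple (fun v : n.-tuple nat => v).
Proof. exact: computable_tnth. Qed.

Lemma computable_tuple_nil n : computable_tuple (fun _ : n.-tuple nat => [tuple]).
Proof. by case. Qed.

Lemma computable_tuple_cons n m F (G : n.-tuple nat -> m.-tuple nat) :
  computable F -> computable_tuple G ->
  computable_tuple (fun v => [tuple of F v :: G v]).
Proof.
move=> cF cG i; case: (unliftP ord0 i) => [j ->|->].
- by apply: eq_computable (cG j) => v; rewrite tnthS.
- by apply: eq_computable cF => v; rewrite tnth0.
Qed.

Lemma computable_tuple_behead n m (G : n.-tuple nat -> m.+1.-tuple nat) :
  computable_tuple G -> computable_tuple (fun v => behead_tuple (G v)).
Proof.
move=> cG i; apply: eq_computable (cG (lift ord0 i)) => v.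
by rewrite {1}(tuple_eta (G v)) tnthS.
Qed.

Lemma computable_thead n : computable (fun v : n.+1.-tuple nat => thead v).
Proof. exact: computable_tnth. Qed.

Lemma computable_succ n (F : n.-tuple nat -> nat) :
  computable F -> computable (fun v => (F v).+1).
Proof.
move=> cF; apply: (@computable_comp 1 n (fun v => (thead v).+1) (fun v => [tuple F v])).
- by exists Succ.
- exact/computable_tuple_cons/computable_tuple_nil.
Qed.

Lemma computable_const n a : computable (fun _ : n.-tuple nat => a).
Proof. by elim: a => [|a /computable_succ//]; exists (Zero n). Qed.

Lemma computable_prec n (b : n.-tuple nat -> nat) (s : n.+2.-tuple nat -> nat) :
  computable b -> computable s ->
  computable (fun v : n.+1.-tuple nat =>
    nat_rect (fun=> nat) (b (behead_tuple v))
      (fun k z => s [tuple of k :: z :: behead_tuple v]) (thead v)).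
Proof.
move=> [f Hf] [g Hg]; exists (Prec f g) => v y /=.
elim: (thead v) y => [|k IHk] y; first exact: Hf.
split=> [[z /IHk ->] /Hg //|->].
by eexists; [apply/IHk; reflexivity | apply/Hg].
Qed.

Lemma computable_iter n (N A : n.-tuple nat -> nat) (s : n.-tuple nat -> nat -> nat) :
  computable N -> computable A ->
  computable (fun u : n.+1.-tuple nat => s (behead_tuple u) (thead u)) ->
  computable (fun v => iter (N v) (s v) (A v)).
Proof.
move=> cN cA cs.
(* Primitive recursion also passes the counter to its step; here it is dropped. *)
have cs' : computable (fun u : n.+2.-tuple nat =>
    s (behead_tuple (behead_tuple u)) (thead (behead_tuple u))).
  exact: (computable_comp cs (computable_tuple_behead (@computable_tuple_id n.+2))).
have := computable_comp (computable_prec cA cs')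
  (computable_tuple_cons cN (@computable_tuple_id n)).
have E m (a : nat) (t : m.-tuple nat) : behead_tuple [tuple of a :: t] = t.
  exact: val_inj.
apply: eq_computable => v; rewrite theadE E.
elim: (N v) => //= k ->; rewrite !E; congr (s v _); exact: theadE.
Qed.

Lemma computable_comp1 n (f : nat -> nat) (F : n.-tuple nat -> nat) :
  recursive f -> computable F -> computable (fun v => f (F v)).
Proof.
move=> [g Hg] cF.
apply: (@computable_comp 1 n (fun v => f (thead v)) (fun v => [tuple F v])).
- exists g => v y; suff -> : v = [tuple thead v] by apply: Hg.
  by case: v => -[|a []] // sz; apply: val_inj.
- exact/computable_tuple_cons/computable_tuple_nil.
Qed.

Lemma computable_add n (F G : n.-tuple nat -> nat) :
  computable F -> computable G -> computable (fun v => F v + G v).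
Proof.
move=> cF cG.
have := computable_iter cF cG (s := fun=> succn) (computable_succ (@computable_thead n)).
by apply: eq_computable => v; elim: (F v) => //= k ->.
Qed.

Lemma computable_mul n (F G : n.-tuple nat -> nat) :
  computable F -> computable G -> computable (fun v => F v * G v).
Proof.
move=> cF cG.
have cG' := computable_comp cG (computable_tuple_behead (@computable_tuple_id n.+1)).
have := computable_iter cF (@computable_const n 0)
  (s := fun v z => G v + z) (computable_add cG' (@computable_thead n)).
by apply: eq_computable => v; elim: (F v) => //= k ->; rewrite mulSn.
Qed.

(** Induction on [l]: prepending [a] is a primitive recursion with base [a] whose step ignores the
    previous value and looks up in the tail. *)
Lemma computable_nth n (l : seq nat) (h : n.-tuple nat -> nat) : computable h ->
  computable (fun v : n.+1.-tuple nat => nth (h (behead_tuple v)) l (thead v)).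
Proof.
move=> ch; elim: l => [|a l IHl].
- apply: eq_computable
    (computable_comp ch (computable_tuple_behead (@computable_tuple_id n.+1))) => v.
  by rewrite nth_nil.
- have cs : computable (fun u : n.+2.-tuple nat =>
      nth (h (behead_tuple (behead_tuple u))) l (thead u)).
    have := computable_comp IHl (computable_tuple_cons (@computable_thead n.+1)
      (computable_tuple_behead (computable_tuple_behead (@computable_tuple_id n.+2)))).
    apply: eq_computable => u; rewrite theadE; congr (nth (h _) _ _); exact: val_inj.
  apply: eq_computable (computable_prec (computable_const n a) cs) => v.
  case: (thead v) => //= k; rewrite theadE; congr (nth (h _) _ _); exact: val_inj.
Qed.

(** * Goedel numbers *)

Lemma pair_code_inj x y x' y' :
  pair_code x y = pair_code x' y' -> x = x' /\ y = y'.
Proof.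
rewrite /pair_code => E.
(* Since [b <= a + b], the code of a pair with sum [s] lies between [s ^ 2] and [s ^ 2 + s], hence
   below [s.+1 ^ 2]: codes determine sums. *)
have lt_code a b a' b' : a + b < a' + b' -> (a + b) ^ 2 + b < (a' + b') ^ 2 + b'.
  move=> lt_ab; apply: (@leq_trans ((a + b).+1 ^ 2)).
  - rewrite -(addn1 (a + b)) (sqrnD (a + b) 1) muln1 -addnA ltn_add2l add1n ltnS.
    by rewrite mul2n -addnn -addnA addnCA leq_addr.
  - by apply: leq_trans (leq_addr _ _); rewrite leq_sqr.
case: (ltngtP (x + y) (x' + y')) => [/lt_code|/lt_code|Exy].
- by rewrite E ltnn.
- by rewrite E ltnn.
- by move: E; rewrite Exy => /addnI Ey; move: Exy; rewrite Ey => /addIn.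
Qed.

Lemma code_term_inj : injective code_term.
Proof.
elim=> [x||t IHt|s IHs t IHt|s IHs t IHt] [x'||t'|s' t'|s' t'] /= /pair_code_inj [//].
- by move=> _ ->.
- by move=> _ /IHt ->.
- by move=> _ /pair_code_inj [/IHs -> /IHt ->].
- by move=> _ /pair_code_inj [/IHs -> /IHt ->].
Qed.

Lemma code_inj : injective code.
Proof.
elim=> [s t||A IHA B IHB|A IHA] [s' t'||A' B'|A'] /= /pair_code_inj [//].
- by move=> _ /pair_code_inj [/code_term_inj -> /code_term_inj ->].
- by move=> _ /pair_code_inj [/IHA -> /IHB ->].
- by move=> _ /IHA ->.
Qed.

(** * Computing the codes of instances of a fixed formula *)

Definition computable_term n (t : n.-tuple nat -> term) :=
  computable (fun v => code_term (t v)).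

Definition computable_form n (A : n.-tuple nat -> form) :=
  computable (fun v => code (A v)).

Lemma computable_pair_code n (F G : n.-tuple nat -> nat) :
  computable F -> computable G -> computable (fun v => pair_code (F v) (G v)).
Proof.
move=> cF cG; have cS := computable_add cF cG.
exact: computable_add (computable_mul cS cS) cG.
Qed.

Lemma computable_numeral n (F : n.-tuple nat -> nat) :
  computable F -> computable_term (fun v => numeral (F v)).
Proof.
move=> cF.
have := computable_iter cF (computable_const n (code_term TZero))
  (s := fun=> pair_code 2)
  (computable_pair_code (computable_const _ 2) (@computable_thead n)).
by apply: eq_computable => v; elim: (F v) => //= k ->.
Qed.

Lemma subst_numeral sigma n : subst_term sigma (numeral n) = numeral n.
Proof. by elim: n => //= n ->. Qed.

(** Unlike computability of [fun v => sigma v x], this property of a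
    substitution [sigma] depending on [v] is stable under [up]. *)
Definition const_or_numeral n (sigma : n.-tuple nat -> nat -> term) : Prop :=
  forall x, (exists t, forall v, sigma v x = t) \/
    exists2 F, computable F & forall v, sigma v x = numeral (F v).

Lemma const_or_numeral_up n (sigma : n.-tuple nat -> nat -> term) :
  const_or_numeral sigma -> const_or_numeral (fun v => up (sigma v)).
Proof.
move=> cs [|x]; first by left; exists (TVar 0).
case: (cs x) => [[t Et]|[F cF EF]].
- by left; exists (subst_term shift t) => v; rewrite /= Et.
- by right; exists F => // v; rewrite /= EF subst_numeral.
Qed.

Lemma computable_subst_term n (sigma : n.-tuple nat -> nat -> term) t :
  const_or_numeral sigma -> computable_term (fun v => subst_term (sigma v) t).
Proof.
move=> cs; elim: t => [x||t IHt|s IHs t IHt|s IHs t IHt] /=.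
- case: (cs x) => [[t Et]|[F cF EF]].
  + by apply: eq_computable (computable_const n (code_term t)) => v; rewrite Et.
  + by apply: eq_computable (computable_numeral cF) => v; rewrite EF.
- exact: computable_const.
- by apply: computable_pair_code => //; apply: computable_const.
- by do 2?[apply: computable_pair_code => //]; apply: computable_const.
- by do 2?[apply: computable_pair_code => //]; apply: computable_const.
Qed.

Lemma computable_Imp n (A B : n.-tuple nat -> form) :
  computable_form A -> computable_form B -> computable_form (fun v => Imp (A v) (B v)).
Proof.
by move=> cA cB; do 2?[apply: computable_pair_code => //]; apply: computable_const.
Qed.

Lemma computable_All n (A : n.-tuple nat -> form) :
  computable_form A -> computable_form (fun v => All (A v)).
Proof. by move=> cA; apply: computable_pair_code => //; apply: computable_const. Qed.

Lemma computable_Neg n (A : n.-tuple nat -> form) :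
  computable_form A -> computable_form (fun v => Neg (A v)).
Proof. by move=> cA; apply: computable_Imp => //; apply: computable_const. Qed.

(** Only the substitution varies with [v]; [A] is fixed, so induction on [A] takes place outside the
    computation, and no substitution on codes has to be programmed. *)
Lemma computable_subst n (sigma : n.-tuple nat -> nat -> term) A :
  const_or_numeral sigma -> computable_form (fun v => subst (sigma v) A).
Proof.
elim: A sigma => [s t||A IHA B IHB|A IHA] sigma cs /=.
- do 2?apply: computable_pair_code; first exact: computable_const.
  + exact: computable_subst_term.
  + exact: computable_subst_term.
- exact: computable_const.
- by apply: computable_Imp; [apply: IHA | apply: IHB].
- by apply/computable_All/IHA/const_or_numeral_up.
Qed.

Lemma computable_K_gt n theta (F G : n.-tuple nat -> nat) :
  computable F -> computable G -> computable_form (fun v => K_gt theta (F v) (G v)).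
Proof.
move=> cF cG; rewrite /K_gt /Ex /And.
do 2!apply: computable_Neg; apply: computable_All.
do 2!apply: computable_Neg; apply: computable_Imp; last first.
  apply: computable_Neg; apply: computable_subst => -[|[|x]].
  - by left; exists (TVar 0).
  - by right; exists F.
  (* From variable 2 on, the substitution takes the default value of [nth]. *)
  - by left; exists TZero => v /=; rewrite nth_nil.
rewrite /Le /Ex; apply: computable_Neg; apply: computable_All; apply: computable_Neg.
do 2?apply: computable_pair_code.
- exact: computable_const.
- exact: computable_const.
- by apply: eq_computable (computable_numeral cG) => v; rewrite subst_numeral.
Qed.

Lemma term_below_subst m n sigma t :
  (forall x, x < m -> term_below n (sigma x)) ->
  term_below m t -> term_below n (subst_term sigma t).
Proof.
move=> Hs; elim: t => [x||t IHt|s IHs t IHt|s IHs t IHt] //=.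
- exact: Hs.
- by case/andP=> /IHs -> /IHt ->.
- by case/andP=> /IHs -> /IHt ->.
Qed.

Lemma form_below_subst m n sigma A :
  (forall x, x < m -> term_below n (sigma x)) ->
  form_below m A -> form_below n (subst sigma A).
Proof.
elim: A m n sigma => [s t||A IHA B IHB|A IHA] m n sigma Hs //=.
- by case/andP=> /(term_below_subst Hs) -> /(term_below_subst Hs) ->.
- by case/andP=> /(IHA _ _ _ Hs) -> /(IHB _ _ _ Hs) ->.
- by apply: IHA => -[|x] // /Hs; apply: term_below_subst.
Qed.

Lemma term_below_numeral n k : term_below n (numeral k).
Proof. by elim: k. Qed.

(** [axioms] retains sentences only, so an added axiom must be closed. *)
Lemma sentence_K_gt theta w e : form_below 2 theta -> sentence (K_gt theta w e).
Proof.
move=> Ht; rewrite /sentence /= subst_numeral term_below_numeral /= !andbT.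
by apply: form_below_subst Ht => -[|[|x]] //= _; apply: term_below_numeral.
Qed.

(** * Truth in the standard model *)

Lemma eq_value rho rho' t : rho =1 rho' -> value rho t = value rho' t.
Proof. by move=> E; elim: t => //= [t ->|s -> t ->|s -> t ->]. Qed.

Lemma value_subst rho sigma t :
  value rho (subst_term sigma t) = value (fun x => value rho (sigma x)) t.
Proof. by elim: t => //= [t ->|s -> t ->|s -> t ->]. Qed.

Lemma value_numeral rho n : value rho (numeral n) = n.
Proof. by elim: n => //= n ->. Qed.

Lemma eq_sat rho rho' A : rho =1 rho' -> sat rho A <-> sat rho' A.
Proof.
elim: A rho rho' => [s t||A IHA B IHB|A IHA] rho rho' E //=.
- by rewrite !(eq_value _ E).
- by split=> H /(IHA _ _ E) /H /(IHB _ _ E).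
- by split=> H a; apply: iffLR (H a); apply: IHA => -[|x] /=.
Qed.

Lemma sat_subst rho sigma A :
  sat rho (subst sigma A) <-> sat (fun x => value rho (sigma x)) A.
Proof.
elim: A rho sigma => [s t||A IHA B IHB|A IHA] rho sigma //=.
- by rewrite !value_subst.
- by split=> H /IHA /H /IHB.
- split=> H a.
  + move/IHA: (H a); apply: iffLR; apply: eq_sat => -[|x] //=.
    by rewrite value_subst; apply: eq_value.
  + apply/IHA; move: (H a); apply: iffLR; apply: eq_sat => -[|x] //=.
    by rewrite value_subst; apply: eq_value.
Qed.

Lemma sat_inst rho t A :
  sat rho (inst t A) <-> sat (fun x => if x is y.+1 then rho y else value rho t) A.
Proof. by apply: (iff_trans (sat_subst _ _ _)); apply: eq_sat => -[]. Qed.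

(** Atoms are decidable equations between numbers, and [Imp] and [All] preserve stability under
    double negation. This validates the rule [P_Contra] without excluded middle. *)
Lemma sat_dne rho A : ~ ~ sat rho A -> sat rho A.
Proof.
elim: A rho => [s t||A IHA B IHB|A IHA] rho /= H.
- by case: (value rho s =P value rho t) => // /H.
- exact: H.
- by move=> HA; apply: IHB => HB; apply: H => /(_ HA).
- by move=> a; apply: IHA => HA; apply: H => /(_ a).
Qed.

Lemma soundness G A : provable G A ->
  forall rho, (forall B, G B -> sat rho B) -> sat rho A.
Proof.
elim=> {G A} [G A GA|G A B _ IH|G A B _ IHAB _ IHA|G A _ IH|G A _ IH|G A t _ IH|G t
  |G A s t _ IHst _ IHA] rho HG //=.
- exact: HG.
- by move=> HA; apply: IH => C [->|/HG].
- exact: IHAB rho HG (IHA rho HG).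
- by apply: sat_dne => HA; apply: (IH rho) => C [->|/HG].
(* Shifted assumptions do not mention the new variable, so they stay true whatever its value [a]. *)
- move=> a; apply: IH => _ [B /HG HB ->]; apply/sat_subst; move: HB.
  by apply: iffLR; apply: eq_sat.
- by apply/sat_inst; apply: IH.
- by have := IHA rho HG => /sat_inst; rewrite (IHst rho HG) => /sat_inst.
Qed.

Lemma robinson_true rho A : robinson A -> sat rho A.
Proof.
case=> //=.
- by move=> a b [].
- by case=> [|a] // _ /(_ a); apply.
- by move=> a; rewrite addn0.
- by move=> a b; rewrite addnS.
- by move=> a; rewrite muln0.
- by move=> a b; rewrite mulnS addnC.
Qed.

(** An [i <= e] with [phi i 0 w] would give [k <= i <= e < k]. *)
Lemma K_gt_true rho phi theta w k e :
  arithmetizes phi theta -> kolmogorov phi w k -> e < k -> sat rho (K_gt theta w e).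
Proof.
(* The goal is [False] throughout, so the double negations hidden in [Ex], [And] and [Le] can be
   stripped. *)
case=> _ _ Ht [_ Kw] lt_ek /=; apply=> i; apply=> Le_i /sat_subst Hi; apply: Le_i => b.
rewrite subst_numeral value_numeral => Eb.
have /Kw le_ki : phi i 0 w.
  apply/Ht; move: Hi; apply: iffLR; apply: eq_sat => -[|[|x]] //=.
  - by rewrite value_numeral.
  - by rewrite !nth_nil.
by move: lt_ek; rewrite ltnNge (leq_trans le_ki) // -Eb leq_addl.
Qed.

(** * The theory [Q] with one additional axiom *)

Definition robinson_axioms : seq form := [::
  All (Neg (Eq (TSucc (TVar 0)) TZero));
  All (All (Imp (Eq (TSucc (TVar 1)) (TSucc (TVar 0))) (Eq (TVar 1) (TVar 0))));
  All (Imp (Neg (Eq (TVar 0) TZero)) (Ex (Eq (TVar 1) (TSucc (TVar 0)))));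
  All (Eq (TAdd (TVar 0) TZero) (TVar 0));
  All (All (Eq (TAdd (TVar 1) (TSucc (TVar 0))) (TSucc (TAdd (TVar 1) (TVar 0)))));
  All (Eq (TMul (TVar 0) TZero) TZero);
  All (All (Eq (TMul (TVar 1) (TSucc (TVar 0)))
               (TAdd (TMul (TVar 1) (TVar 0)) (TVar 1))))].

Lemma robinson_axiomsP A : robinson A <->
  exists2 n, n < size robinson_axioms & nth Bot robinson_axioms n = A.
Proof.
split; last by case=> -[|[|[|[|[|[|[|n]]]]]]] // _ <- /=; constructor.
by case; [exists 0|exists 1|exists 2|exists 3|exists 4|exists 5|exists 6].
Qed.

Lemma robinson_sentence A : robinson A -> sentence A.
Proof. by case. Qed.

(** Past the axioms of [Q], the default value [a] of [nth] is the code of the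
    additional axiom. *)
Definition Q_code (a n : nat) : nat := nth a (map code robinson_axioms) n.

(** Every enumerated axiom is true in the standard model, so soundness gives consistency; [code_inj]
    recovers the axiom from its code. *)
Lemma admissible_Q_code phi d A :
  (forall n z, phi d n z <-> z = Q_code (code A) n) -> sentence A ->
  (forall rho, sat rho A) -> admissible phi d /\ provable (axioms phi d) A.
Proof.
move=> Hd sA tA; split; last first.
  apply: P_Hyp; split=> //; exists (size robinson_axioms); apply/Hd.
  by rewrite /Q_code nth_default ?size_map.
split=> [/soundness H|B /[dup] /robinson_axiomsP [n lt_n <-] /robinson_sentence sB].
  apply: (H (fun=> 0)) => B [_ [n /Hd]]; rewrite /Q_code.
  case: (ltnP n (size robinson_axioms)) => lt_n.
    rewrite (nth_map Bot) // => /code_inj ->.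
    by apply: robinson_true; apply/robinson_axiomsP; exists n.
  by rewrite nth_default ?size_map // => /code_inj ->.
apply: P_Hyp; split=> //; exists n; apply/Hd.
by rewrite /Q_code (nth_map Bot).
Qed.

Lemma computable_Q_code n (F G : n.-tuple nat -> nat) :
  computable F -> computable G -> computable (fun v => Q_code (F v) (G v)).
Proof.
move=> cF cG.
have := computable_comp (computable_nth (map code robinson_axioms) cF)
  (computable_tuple_cons cG (@computable_tuple_id n)).
apply: eq_computable => v; rewrite theadE /Q_code; congr (nth (F _) _ _).
exact: val_inj.
Qed.

(** * Iterated extension of [Q] and diagonalization *)

Theorem theorem3p5 (phi : numbering) (hphi : acceptable phi)
    (theta : form) (htheta : arithmetizes phi theta)
    (c : prf 1)
    (hc : forall d, admissible phi d ->
       exists2 cT, eval c [tuple d] cT &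
         forall e w, cT <= e -> ~ provable (axioms phi d) (K_gt theta w e)) :
  ~ exists w : prf 1, forall d, admissible phi d ->
      exists cT wT,
        [/\ eval c [tuple d] cT,
            eval w [tuple d] wT,
            ~ provable (axioms phi d) (K_gt theta wT cT) &
            exists2 k, kolmogorov phi wT k & cT < k].
Proof.
case: hphi => -[u Hu] onto smn [w Hw].
(* The starting theory is [Q] with the trivial extra axiom [Imp Bot Bot]. *)
have [d0 Ad0] : exists d, admissible phi d.
  have [f Hf] := computable_Q_code (computable_const 1 (code (Imp Bot Bot)))
    (@computable_thead 0).
  have [d Hd] := onto f; exists d.
  apply: (proj1 (admissible_Q_code (A := Imp Bot Bot) _ _ _)) => // [n z|rho //].
  exact: iff_trans (Hd _ _) (Hf _ _).
(* [s] is total by s-m-n, but [s d] is described only where [c] and [w] converge at [d]. *)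
have [s rs Hs] : exists2 s, recursive s & forall d cT wT n z,
    eval c [tuple d] cT -> eval w [tuple d] wT ->
    phi (s d) n z <-> z = Q_code (code (K_gt theta wT cT)) n.
  have [g Hg] := computable_Q_code
    (computable_K_gt theta (computable_tnth (lift ord0 ord0 : 'I_3))
      (computable_tnth (lift ord0 (lift ord0 ord0))))
    (@computable_thead 2).
  (* On input [(d, n)] the three components yield [n], [w(d)] and [c(d)], the argument order of
     [g]. *)
  have [s rs Hs] := smn (Comp g (tnth [tuple Proj (ord_max : 'I_2);
    Comp w (fun=> Proj (ord0 : 'I_2)); Comp c (fun=> Proj (ord0 : 'I_2))])).
  exists s => // d cT wT n z Hc Hwd.
  apply: (iff_trans (Hs _ _ _)); apply: iff_trans (Hg [tuple n; wT; cT] z).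
  apply: eval_comp => -[[|[|[|i]]] lt_i] //=; exists [tuple d]; split=> //.
  - by case=> -[].
  - by case=> -[].
have As d cT wT : admissible phi d -> eval c [tuple d] cT -> eval w [tuple d] wT ->
    admissible phi (s d) /\ provable (axioms phi (s d)) (K_gt theta wT cT).
  move=> Ad Hc Hwd; have [cT' [wT' [Hc' Hw' _ [k Kk lt_k]]]] := Hw d Ad.
  rewrite (eval_functional Hc Hc') (eval_functional Hwd Hw').
  apply: admissible_Q_code => [n z||rho]; first exact: Hs.
  - by apply: sentence_K_gt; case: htheta.
  - exact: K_gt_true htheta Kk lt_k.
pose D n := iter n s d0.
have HD n : admissible phi (D n) /\ exists2 cT, eval c [tuple D n] cT & n <= cT.
  elim: n => [|n [An [cT Hc le_n]]].
    by split=> //; have [cT Hc _] := hc d0 Ad0; exists cT.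
  have [_ [wT [_ Hwd _ _]]] := Hw _ An.
  have [As1 Ps] := As _ _ _ An Hc Hwd; split=> //.
  have [cT' Hc' Hn] := hc _ As1; exists cT' => //.
  (* If [cT' <= cT], then [hc] would forbid the new theory to prove its own axiom
     [K_gt theta wT cT]; so each step raises the constant. *)
  by apply: leq_ltn_trans le_n _; rewrite ltnNge; apply/negP => /Hn /(_ Ps).
have [D' HD'] : computable (fun v : 1.-tuple nat => D (thead v)).
  apply: computable_iter (computable_thead _) (computable_const _ d0) _.
  exact: computable_comp1 rs (computable_thead _).
(* Diagonalization: [t i] is an index of [w(D(phi_i(i)))], hence with [phi_e = t]
   the number [t e] is an index of [w(D(t e))]. *)
have [t [t' Ht'] Ht] := smn
  (Comp w (fun=> Comp D' (fun=> Comp u (fun=> Proj (ord0 : 'I_2))))).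
have [e He] := onto t'; pose p := t e.
have [Ap [cT Hc le_p]] := HD p.
have [cT' [wT [Hc' Hwp _ [k [_ Kk] lt_k]]]] := Hw _ Ap.
(* As [p <= cT < k], it suffices for a contradiction that [k <= p], which follows from
   [phi p 0 wT]. *)
move: lt_k; rewrite -(eval_functional Hc Hc') ltnNge (leq_trans _ le_p) //.
apply/Kk/Ht; exists [tuple D p]; split=> // -[[|//] lt0].
exists [tuple p]; split=> [|/=]; last exact/HD'.
(* The innermost call is phi_e(e), which equals [t e], that is, [p]. *)
move=> -[[|//] lt1]; exists [tuple e; e]; split; first by case=> -[|[]].
by apply/Hu/He/Ht'.
Qed.
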